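(* Let $\mu\in\mathbb{C}$, let $n\ge 1$ be an integer, and let $t\in(-1,1)$. Let $T_{\mu,n}$ and $U_{\mu,n-1}$ be the exponential Chebyshev functions and $U_k$ the Chebyshev polynomials of the second kind. Then $$\frac{1}{\pi}\int_{-1}^{1}\frac{\cosh[\mu(t-s)]}{t-s}\frac{T_{\mu,n}(s)}{\sqrt{1-s^2}}\,ds=-e^{-\mu t}\sum_{k=0}^{n-1}\frac{1}{k!}\mu^k U_{n-1-k}(t),$$ and $$\frac{1}{\pi}\int_{-1}^{1}\frac{\cosh[\mu(t-s)]}{t-s}U_{\mu,n-1}(s)\sqrt{1-s^2}\,ds=\frac{e^{-\mu t}}{2}\begin{cases}U_1(t)+\mu, & n=1,\\[4pt] \displaystyle\sum_{k=0}^{n}\frac{1}{k!}\mu^k U_{n-k}(t)-\sum_{k=0}^{n-2}\frac{1}{k!}\mu^k U_{n-2-k}(t), & n\ge 2.\end{cases}$$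
   Context: For $\mu\in\mathbb{C}$, integer $n\ge 0$ and $s\in(-1,1)$, the exponential Chebyshev functions are $$T_{\mu,n}(s)=\frac{1}{2}\left[e^{-i\mu\sqrt{1-s^2}}(s+i\sqrt{1-s^2})^n+e^{i\mu\sqrt{1-s^2}}(s-i\sqrt{1-s^2})^n\right],$$ $$U_{\mu,n}(s)=\frac{1}{2i\sqrt{1-s^2}}\left[e^{-i\mu\sqrt{1-s^2}}(s+i\sqrt{1-s^2})^{n+1}-e^{i\mu\sqrt{1-s^2}}(s-i\sqrt{1-s^2})^{n+1}\right];$$ equivalently, for $\theta\in(0,\pi)$, $T_{\mu,n}(\cos\theta)=\cos(n\theta-\mu\sin\theta)$ and $U_{\mu,n}(\cos\theta)=\sin((n+1)\theta-\mu\sin\theta)/\sin\theta$. $U_k$ denotes the Chebyshev polynomial of the second kind, $U_k(\cos\theta)=\sin((k+1)\theta)/\sin\theta$ (so $U_0=1$, $U_1(t)=2t$). Here $\mu^0=1$, $\sqrt{1-s^2}$ is the positive square root, and integrals with kernel $1/(t-s)$ are Cauchy principal values at $s=t$. *)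

(* Defs.v *)
From Stdlib Require Export Reals Factorial.
From Coquelicot Require Export Coquelicot.
From Stdlib Require Import Lra.
Open Scope R_scope.

Definition Cexp (z : C) : C :=
  (exp (Re z) * cos (Im z), exp (Re z) * sin (Im z)).

Definition Ccosh (z : C) : C := ((Cexp z + Cexp (- z)) / 2)%C.

Definition expT (mu : C) (n : nat) (s : R) : C :=
  (/ 2 * (Cexp (- (Ci * mu * sqrt (1 - s ^ 2))) * (s + Ci * sqrt (1 - s ^ 2)) ^ n
        + Cexp (Ci * mu * sqrt (1 - s ^ 2)) * (s - Ci * sqrt (1 - s ^ 2)) ^ n))%C.

Definition expU (mu : C) (n : nat) (s : R) : C :=
  (/ (2 * Ci * sqrt (1 - s ^ 2)) *
     (Cexp (- (Ci * mu * sqrt (1 - s ^ 2))) * (s + Ci * sqrt (1 - s ^ 2)) ^ (n + 1)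
    - Cexp (Ci * mu * sqrt (1 - s ^ 2)) * (s - Ci * sqrt (1 - s ^ 2)) ^ (n + 1)))%C.

Fixpoint chebU (k : nat) (t : R) : R :=
  match k with
  | O => 1
  | S k' => match k' with
            | O => 2 * t
            | S k'' => 2 * t * chebU k' t - chebU k'' t
            end
  end.

Lemma chebU_cos (k : nat) (theta : R) :
  0 < theta < PI -> chebU k (cos theta) = sin ((INR k + 1) * theta) / sin theta.
Proof.
intros Ht.
assert (Hs : sin theta <> 0) by (apply Rgt_not_eq, sin_gt_0; lra).
cut (chebU k (cos theta) = sin ((INR k + 1) * theta) / sin theta /\
     chebU (S k) (cos theta) = sin ((INR (S k) + 1) * theta) / sin theta);
  [tauto|].
induction k as [|k [IH1 IH2]].
- split.
  + simpl. replace ((0 + 1) * theta) with theta by ring. field. exact Hs.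
  + simpl. replace ((1 + 1) * theta) with (2 * theta) by ring.
    rewrite sin_2a. field. exact Hs.
- split; [exact IH2|].
  change (2 * cos theta * chebU (S k) (cos theta) - chebU k (cos theta) =
          sin ((INR (S (S k)) + 1) * theta) / sin theta).
  rewrite IH1, IH2, !S_INR.
  set (a := (INR k + 1 + 1) * theta).
  replace ((INR k + 1) * theta) with (a - theta) by (unfold a; ring).
  replace ((INR k + 1 + 1 + 1) * theta) with (a + theta) by (unfold a; ring).
  rewrite sin_plus, sin_minus. field. exact Hs.
Qed.

(* Cauchy principal value at [t] of the integral of [f] over ]a, b[: the
   excision is symmetric about [t], and the one-sided integrals are improper
   at [a] and [b], where [f] may be unbounded or carry junk values. *)
Definition is_PV_int (f : R -> C) (a b t : R) (l : C) : Prop :=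
  exists J1 J2 : R -> C,
    at_right 0 (fun eps =>
      is_RInt_gen (V := C_R_NormedModule) f (at_right a) (at_point (t - eps)) (J1 eps) /\
      is_RInt_gen (V := C_R_NormedModule) f (at_point (t + eps)) (at_left b) (J2 eps)) /\
    filterlim (fun eps => (J1 eps + J2 eps)%C) (at_right 0) (locally l).

Lemma is_PV_int_unique (f : R -> C) (a b t : R) (l1 l2 : C) :
  is_PV_int f a b t l1 -> is_PV_int f a b t l2 -> l1 = l2.
Proof.
intros [J1 [J2 [HJ LJ]]] [K1 [K2 [HK LK]]].
apply (filterlim_locally_unique (V := C_R_NormedModule) (F := at_right 0)
         (fun eps => (J1 eps + J2 eps)%C)); [exact LJ|].
refine (filterlim_ext_loc _ _ _ LK).
generalize (filter_and _ _ HJ HK); apply filter_imp.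
intros eps [[A1 A2] [B1 B2]].
rewrite <- (is_RInt_gen_unique (V := C_R_CompleteNormedModule) _ _ A1).
rewrite <- (is_RInt_gen_unique (V := C_R_CompleteNormedModule) _ _ A2).
rewrite <- (is_RInt_gen_unique (V := C_R_CompleteNormedModule) _ _ B1).
rewrite <- (is_RInt_gen_unique (V := C_R_CompleteNormedModule) _ _ B2).
reflexivity.
Qed.

(* Main.v *)
Require Import Defs.
From Stdlib Require Import Arith Reals Factorial Lra Lia.
From Coquelicot Require Import Coquelicot.
Open Scope R_scope.

(** Put [s = cos x] and [t = cos y].  Since [T_{mu,n}(s)] and the hyperbolic
    cosine combine into exponentials of [mu e^{ix}] and [mu e^{-ix}], the numerator
    [cosh (mu (t - s)) T_{mu,n}(s)] is a sum of two rapidly convergent cosine series,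
    [e^{mu t}/2 * sum (-mu)^k/k! cos((n+k)x)] and
    [e^{-mu t}/2 * sum mu^k/k! cos(|n-k|x)].  For a single cosine,
    [(cos mx - cos my) / (cos x - cos y)] is a trigonometric polynomial with integral
    [PI sin(my)/sin y] over [[0, PI]], and the principal value of
    [1/((t-s) sqrt(1-s^2))] vanishes, as its explicit primitive shows.  Summing,
    the infinite tails of the two series cancel because [sin((n-k)y)] is odd in
    [n-k], whereas the second series involves [sin(|n-k|y)]; what remains is twice the
    part [k < n].  The formula for [U_{mu,n-1}] follows from
    [2 (1-s^2) U_{mu,n-1} = T_{mu,n-1} - T_{mu,n+1}] with [n = 0] allowed in the
    first formula. *)

(** * The power series of the complex exponential *)

Lemma filterlim_C {T : Type} (F : (T -> Prop) -> Prop) {FF : Filter F} (f : T -> C) (l : C) :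
  filterlim (fun x => Re (f x)) F (locally (Re l)) ->
  filterlim (fun x => Im (f x)) F (locally (Im l)) ->
  filterlim f F (locally l).
Proof.
intros H1 H2.
apply filterlim_locally; intros eps.
generalize (filter_and _ _ (proj1 (filterlim_locally _ _) H1 eps)
                           (proj1 (filterlim_locally _ _) H2 eps)).
apply filter_imp; intros x [A B]; split; assumption.
Qed.

Lemma Cexp_plus (z w : C) : Cexp (z + w) = (Cexp z * Cexp w)%C.
Proof.
destruct z as [a b], w as [c d]; unfold Cexp, Cmult; simpl.
rewrite exp_plus, cos_plus, sin_plus; f_equal; ring.
Qed.

Lemma Cexp_0 : Cexp 0 = 1.
Proof. unfold Cexp; simpl; rewrite exp_0, cos_0, sin_0; unfold RtoC; f_equal; ring. Qed.

(** Each derivative in [x] only multiplies the weight [w] by [z], so all Taylor coefficients at 0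
    have the same form. *)
Definition exp_seg (z w : C) (x : R) : R := Re (w * Cexp (x * z)).

Lemma is_derive_exp_seg (z w : C) (x : R) :
  is_derive (exp_seg z w) x (exp_seg z (w * z) x).
Proof.
destruct z as [a b], w as [u v]; unfold exp_seg, Cexp; simpl.
auto_derive; [easy|].
replace (x * a + - (0 * b)) with (x * a - 0 * b) by ring; ring.
Qed.

Lemma is_derive_n_exp_seg (k : nat) (z w : C) (x : R) :
  is_derive_n (exp_seg z w) k x (exp_seg z (w * z ^ k) x).
Proof.
revert x; induction k as [|k IH]; intros x.
- simpl; now rewrite Cmult_1_r.
- simpl. apply is_derive_ext with (exp_seg z (w * z ^ k)).
  + intros y; symmetry; apply is_derive_n_unique, IH.
  + replace (w * (z * z ^ k))%C with (w * z ^ k * z)%C by ring.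
    apply is_derive_exp_seg.
Qed.

Lemma Cmod_Cexp (z : C) : Cmod (Cexp z) = exp (Re z).
Proof.
unfold Cexp, Cmod; simpl.
replace (_ + _) with (exp (Re z) ^ 2 * ((sin (Im z))² + (cos (Im z))²)) by (unfold Rsqr; ring).
rewrite sin2_cos2, Rmult_1_r; apply sqrt_pow2, Rlt_le, exp_pos.
Qed.

Lemma exp_monotone (x y : R) : x <= y -> exp x <= exp y.
Proof. intros [H| ->]; [left; now apply exp_increasing|right; reflexivity]. Qed.

(** On the unit segment [Re (x * z)] is at most [|z|]; the bound is independent of [x], hence of the
    intermediate point in Lagrange's remainder. *)
Lemma exp_seg_bound (z w : C) (x : R) : 0 <= x <= 1 ->
  Rabs (exp_seg z w x) <= Cmod w * exp (Cmod z).
Proof.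
intros Hx; unfold exp_seg.
apply Rle_trans with (Cmod (w * Cexp (x * z))).
{ eapply Rle_trans; [|apply Rmax_Cmod]; apply Rmax_l. }
rewrite Cmod_mult, Cmod_Cexp.
apply Rmult_le_compat_l; [apply Cmod_ge_0|].
apply exp_monotone.
replace (Re (x * z)) with (x * Re z) by (destruct z; simpl; ring).
assert (H : Rabs (Re z) <= Cmod z) by (eapply Rle_trans; [|apply Rmax_Cmod]; apply Rmax_l).
apply Rle_trans with (x * Cmod z).
- apply Rmult_le_compat_l; [lra|]. eapply Rle_trans; [apply Rle_abs|exact H].
- rewrite <- (Rmult_1_l (Cmod z)) at 2; apply Rmult_le_compat_r; [apply Cmod_ge_0|lra].
Qed.

(** Up to the factor [c], this is the general term of the convergent series of [exp x]. *)
Lemma is_lim_seq_exp_remainder (x c : R) :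
  is_lim_seq (fun n => c * (x ^ S n / INR (fact (S n)))) 0.
Proof.
replace (Finite 0) with (Rbar_mult c 0) by (simpl; f_equal; ring).
apply is_lim_seq_scal_l.
apply (is_lim_seq_incr_1 (fun n => x ^ n / INR (fact n))).
apply ex_series_lim_0.
exists (exp x).
eapply is_series_ext; [|exact (is_exp_Reals x)].
intros n; unfold scal; simpl; unfold mult; simpl.
rewrite pow_n_pow; reflexivity.
Qed.

Definition Cexp_term (z : C) (k : nat) : C := (1 / INR (fact k) * z ^ k)%C.

Lemma Re_mult_sum_n (w : C) (a : nat -> C) (n : nat) :
  Re (w * sum_n a n) = sum_f_R0 (fun k => Re (w * a k)) n.
Proof.
induction n as [|n IH].
- now rewrite sum_O.
- rewrite sum_Sn, tech5, <- IH.
  unfold plus; simpl; ring.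
Qed.

(* Taylor-Lagrange for the real function [x |-> Re (w e^{xz})]; the weight [w]
   gives both the real part ([w = 1]) and the imaginary part ([w = -i]). *)
Lemma is_lim_seq_Re_Cexp (z w : C) :
  is_lim_seq (fun n => Re (w * sum_n (Cexp_term z) n)) (Re (w * Cexp z)).
Proof.
set (c := Cmod w * exp (Cmod z)).
apply is_lim_seq_le_le with
  (u := fun n => Re (w * Cexp z) - c * (Cmod z ^ S n / INR (fact (S n))))
  (w := fun n => Re (w * Cexp z) + c * (Cmod z ^ S n / INR (fact (S n)))).
- intros n.
  (* The remainder is at most [c |z|^(n+1) / (n+1)!] in absolute value, which squeezes the partial
     sums. *)
  destruct (Taylor_Lagrange (exp_seg z w) n 0 1 Rlt_0_1) as [x [Hx E]].
  { intros y _ k _; destruct k; [easy|].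
    eexists; apply (is_derive_n_exp_seg (S k)). }
  assert (E1 : exp_seg z w 1 = Re (w * Cexp z)) by (unfold exp_seg; now rewrite Cmult_1_l).
  rewrite E1 in E; rewrite E.
  rewrite Re_mult_sum_n.
  rewrite (sum_eq _ (fun k => Re (w * Cexp_term z k))).
  2:{ intros k _. rewrite (is_derive_n_unique _ _ _ _ (is_derive_n_exp_seg k z w 0)).
      unfold exp_seg, Cexp_term. rewrite Cmult_0_l, Cexp_0, Rminus_0_r, pow1.
      rewrite <- RtoC_div by apply INR_fact_neq_0.
      destruct w, (z ^ k)%C; simpl; field; apply INR_fact_neq_0. }
  rewrite (is_derive_n_unique _ _ _ _ (is_derive_n_exp_seg (S n) z w x)).
  rewrite Rminus_0_r, pow1.
  assert (B : Rabs (1 / INR (fact (S n)) * exp_seg z (w * z ^ S n) x)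
              <= c * (Cmod z ^ S n / INR (fact (S n)))).
  { rewrite Rabs_mult.
    assert (P := INR_fact_lt_0 (S n)).
    rewrite (Rabs_pos_eq (1 / _)) by (apply Rlt_le, Rdiv_lt_0_compat; lra).
    eapply Rle_trans.
    - apply Rmult_le_compat_l; [apply Rlt_le, Rdiv_lt_0_compat; lra|].
      apply exp_seg_bound; lra.
    - rewrite Cmod_mult, Cmod_pow; unfold c; right; field; lra. }
  apply Rabs_le_between in B; lra.
- replace (Finite (Re _)) with (Rbar_minus (Re (w * Cexp z)) 0) by (simpl; f_equal; ring).
  apply is_lim_seq_minus'; [apply is_lim_seq_const|apply is_lim_seq_exp_remainder].
- replace (Finite (Re _)) with (Rbar_plus (Re (w * Cexp z)) 0) by (simpl; f_equal; ring).
  apply is_lim_seq_plus'; [apply is_lim_seq_const|apply is_lim_seq_exp_remainder].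
Qed.

Lemma is_series_Cexp (z : C) : is_series (Cexp_term z) (Cexp z).
Proof.
apply (filterlim_C eventually).
- generalize (is_lim_seq_Re_Cexp z 1); rewrite Cmult_1_l.
  apply filterlim_ext; intros n; now rewrite Cmult_1_l.
- generalize (is_lim_seq_Re_Cexp z (- Ci)).
  replace (Re (- Ci * Cexp z)) with (Im (Cexp z)) by (destruct (Cexp z); simpl; lra).
  apply filterlim_ext; intros n.
  cut (forall a : C, Re (- Ci * a) = Im a); [intros H; exact (H _)|].
  intros [a b]; simpl; ring.
Qed.

(** * Chebyshev recurrences and quotients of cosine differences *)

(* Index shifted by one, so that [chebV m (cos x) = sin (m x) / sin x]. *)
Definition chebV (m : nat) (t : R) : R :=
  match m with O => 0 | S k => chebU k t end.

Lemma chebV_SS (m : nat) (t : R) : chebV (S (S m)) t = 2 * t * chebV (S m) t - chebV m t.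
Proof. destruct m as [|m]; [simpl; ring|reflexivity]. Qed.

Lemma nat_two_step_ind (P : nat -> Prop) :
  P 0%nat -> P 1%nat -> (forall m, P m -> P (S m) -> P (S (S m))) -> forall m, P m.
Proof.
intros H0 H1 HS m.
enough (P m /\ P (S m)) by tauto.
induction m; [split; assumption|split; [tauto|now apply HS]].
Qed.

Lemma cos_SS (m : nat) (x : R) :
  cos (INR (S (S m)) * x) = 2 * cos x * cos (INR (S m) * x) - cos (INR m * x).
Proof.
rewrite !S_INR.
replace ((INR m + 1 + 1) * x) with ((INR m + 1) * x + x) by ring.
replace (INR m * x) with ((INR m + 1) * x - x) by ring.
rewrite cos_plus, cos_minus; ring.
Qed.

Lemma chebV_sin (m : nat) (x : R) : sin x * chebV m (cos x) = sin (INR m * x).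
Proof.
induction m as [| |m IH1 IH2] using nat_two_step_ind.
- simpl; rewrite Rmult_0_l, sin_0; ring.
- simpl; rewrite Rmult_1_l; ring.
- rewrite chebV_SS.
  replace (sin x * _) with (2 * cos x * (sin x * chebV (S m) (cos x)) - sin x * chebV m
      (cos x)) by ring.
  rewrite IH1, IH2, !S_INR.
  replace ((INR m + 1 + 1) * x) with ((INR m + 1) * x + x) by ring.
  replace (INR m * x) with ((INR m + 1) * x - x) by ring.
  rewrite sin_plus, sin_minus; ring.
Qed.

(* The quotient [(cos mx - cos my) / (cos x - cos y)] for [t = cos y]; the
   recurrence has [2 cos mx] as inhomogeneity, so that its integral over [[0, PI]]
   satisfies the recurrence of [chebV]. *)
Fixpoint cosq (t x : R) (m : nat) : R :=
  match m with
  | O => 0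
  | S m' => match m' with
            | O => 1
            | S m'' => 2 * t * cosq t x m' - cosq t x m'' + 2 * cos (INR m' * x)
            end
  end.

Lemma cosq_SS (t x : R) (m : nat) :
  cosq t x (S (S m)) = 2 * t * cosq t x (S m) - cosq t x m + 2 * cos (INR (S m) * x).
Proof. reflexivity. Qed.

(** In the difference of the cosine recurrences at [x] and at [y], trading the factor [2 cos x] for
    [2 cos y] leaves [2 (cos x - cos y) cos ((m+1)x)]: the inhomogeneity of [cosq] times
    [cos x - cos y]. *)
Lemma cosq_spec (y x : R) (m : nat) :
  (cos x - cos y) * cosq (cos y) x m = cos (INR m * x) - cos (INR m * y).
Proof.
induction m as [| |m IH1 IH2] using nat_two_step_ind.
- simpl; rewrite !Rmult_0_l; ring.
- simpl; rewrite !Rmult_1_l; ring.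
- rewrite cosq_SS, !cos_SS.
  transitivity (2 * cos y * ((cos x - cos y) * cosq (cos y) x (S m))
    - (cos x - cos y) * cosq (cos y) x m
    + 2 * (cos x - cos y) * cos (INR (S m) * x)); [ring|].
  rewrite IH1, IH2; ring.
Qed.

(** The base 3 works because [2 * 3^(m+1) + 3^m + 2 <= 3^(m+2)]. Exponential growth is harmless: the
    coefficients to come decay like [|mu|^k / k!]. *)
Lemma cosq_bound (t x : R) (m : nat) : -1 < t < 1 -> Rabs (cosq t x m) <= 3 ^ m.
Proof.
intros Ht; induction m as [| |m IH1 IH2] using nat_two_step_ind.
- simpl; rewrite Rabs_R0; lra.
- simpl; rewrite Rabs_R1; lra.
- rewrite cosq_SS.
  assert (C := COS_bound (INR (S m) * x)).
  assert (P : 1 <= 3 ^ m) by (apply pow_R1_Rle; lra).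
  apply Rabs_le_between in IH1, IH2.
  rewrite !Rabs_le_between; simpl pow in *.
  assert (A : Rabs (t * cosq t x (S m)) <= 3 * 3 ^ m).
  { rewrite Rabs_mult, <- (Rmult_1_l (3 * 3 ^ m)).
    apply Rmult_le_compat; try apply Rabs_pos; apply Rabs_le_between; lra. }
  apply Rabs_le_between in A. lra.
Qed.

Lemma continuous_cosq (t : R) (m : nat) (x : R) : continuous (fun x => cosq t x m) x.
Proof.
induction m as [| |m IH1 IH2] using nat_two_step_ind.
- apply continuous_const.
- apply continuous_const.
- apply (continuous_plus (V := R_NormedModule) (fun x => 2 * t * cosq t x (S m) - cosq t x m)).
  + apply (continuous_minus (V := R_NormedModule)); [|exact IH1].
    apply (continuous_scal_r (V := R_NormedModule) (2 * t)); exact IH2.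
  + apply (ex_derive_continuous (V := R_NormedModule)); auto_derive; easy.
Qed.

Lemma is_RInt_cosq (t : R) (m : nat) :
  is_RInt (fun x => cosq t x m) 0 PI (PI * chebV m t).
Proof.
induction m as [| |m IH1 IH2] using nat_two_step_ind.
- replace (PI * chebV 0 t) with (scal (PI - 0) 0) by
    (unfold scal; simpl; unfold mult; simpl; ring).
  apply (is_RInt_const (V := R_NormedModule)).
- replace (PI * chebV 1 t) with (scal (PI - 0) 1) by
    (unfold scal; simpl; unfold mult; simpl; ring).
  apply (is_RInt_const (V := R_NormedModule)).
- rewrite chebV_SS.
  (* The frequency is a positive integer, so the primitive [2 / r * sin (r * x)] vanishes at both
     [0] and [PI]. *)
  assert (K : is_RInt (fun x => 2 * cos (INR (S m) * x)) 0 PI 0).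
  { assert (N : INR (S m) <> 0) by (apply not_0_INR; lia).
    assert (Z : sin (INR (S m) * PI) = 0).
    { apply sin_eq_0_1; exists (Z.of_nat (S m)); now rewrite INR_IZR_INZ. }
    revert N Z; generalize (INR (S m)); intros r N Z.
    replace 0 with (minus (2 / r * sin (r * PI)) (2 / r * sin (r * 0))) at 2.
    - apply (is_RInt_derive (V := R_CompleteNormedModule) (fun x => 2 / r * sin (r * x))).
      + intros x _; auto_derive; [easy|field; exact N].
      + intros x _; apply (ex_derive_continuous (V := R_NormedModule)); auto_derive; easy.
    - rewrite Z, (Rmult_0_r r), sin_0; unfold minus, plus, opp; simpl; ring. }
  replace (PI * (2 * t * chebV (S m) t - chebV m t))
    with (plus (minus (scal (2 * t) (PI * chebV (S m) t)) (PI * chebV m t)) 0)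
    by (unfold minus, plus, opp, scal; simpl; unfold mult; simpl; ring).
  apply (is_RInt_plus (V := R_NormedModule) (fun x => 2 * t * cosq t x (S m) - cosq t x m));
      [|exact K].
  apply (is_RInt_minus (V := R_NormedModule)); [|exact IH1].
  apply (is_RInt_scal (V := R_NormedModule)); exact IH2.
Qed.

(** * Term-by-term integration of uniformly convergent series *)

Lemma is_RInt_RtoC (f : R -> R) (c : C) (a b l : R) :
  is_RInt f a b l ->
  is_RInt (V := C_R_NormedModule) (fun x => (c * f x)%C) a b (c * l)%C.
Proof.
intros H; destruct c as [u v].
replace ((u, v) * l)%C with (scal u l, scal v l)
  by (unfold Cmult, RtoC, scal; simpl; unfold mult; simpl; f_equal; ring).
apply (is_RInt_fct_extend_pair (U := R_NormedModule) (V := R_NormedModule));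
  (eapply is_RInt_ext; [|apply (is_RInt_scal (V := R_NormedModule)), H]);
  intros x _; unfold scal; simpl; unfold mult; simpl; ring.
Qed.

Lemma continuous_RtoC (f : R -> R) (c : C) (x : R) :
  continuous f x -> continuous (U := C_UniformSpace) (fun x => (c * f x)%C) x.
Proof.
intros H; destruct c as [u v]; apply (filterlim_C (locally x)).
- replace (Re ((u, v) * f x)) with (u * f x) by (simpl; ring).
  apply (filterlim_ext (fun x => u * f x)); [intros y; simpl; ring|].
  apply (continuous_scal_r (V := R_NormedModule) u f); exact H.
- replace (Im ((u, v) * f x)) with (v * f x) by (simpl; ring).
  apply (filterlim_ext (fun x => v * f x)); [intros y; simpl; ring|].
  apply (continuous_scal_r (V := R_NormedModule) v f); exact H.
Qed.

(** The Weierstrass M-test: the tails of [M] bound differences of partial sums uniformly in [x], so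
    these are Cauchy in the complete space of functions. *)
Lemma uniform_series (b : nat -> R -> C) (M : nat -> R) :
  (forall k x, Cmod (b k x) <= M k) -> ex_series M ->
  exists g : R -> C,
    filterlim (U := fct_UniformSpace R C_R_NormedModule)
      (fun n x => sum_n (fun k => b k x) n) eventually
          (locally (T := fct_UniformSpace R C_R_NormedModule) g).
Proof.
intros HM HS.
apply (filterlim_locally_cauchy (U := @fct_CompleteSpace R C_R_CompleteNormedModule)
    (F := eventually)).
intros eps.
destruct (Cauchy_ex_series _ HS eps) as [N HN].
exists (le N); split; [exists N; tauto|].
assert (H : forall u v x, (N <= u)%nat -> (u < v)%nat ->
  Cmod (minus (G := C_NormedModule) (sum_n (G := C_NormedModule) (fun k => b k x) v)
                                    (sum_n (G := C_NormedModule) (fun k => b k x) u)) < eps).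
{ intros u v x Hu Hv.
  rewrite <- (sum_n_m_sum_n (G := C_NormedModule)) by lia.
  change (norm (K := C_AbsRing) (V := C_NormedModule) (sum_n_m (fun k => b k x) (S u) v) < eps).
  eapply Rle_lt_trans; [apply (norm_sum_n_m (V := C_NormedModule))|].
  eapply Rle_lt_trans; [apply (sum_n_m_le _ M); intros k; apply HM|].
  eapply Rle_lt_trans; [apply Rle_abs|].
  apply HN; lia. }
intros u v Hu Hv x.
destruct (Nat.lt_trichotomy u v) as [L|[L|L]].
- apply (norm_compat1 (V := C_NormedModule)); apply H; assumption.
- subst; apply (ball_center (M := C_UniformSpace)).
- apply (ball_sym (M := C_UniformSpace)), (norm_compat1 (V := C_NormedModule)); apply H;
    assumption.
Qed.

(** The singularity at [cos x = cos y] is divided out term by term: [g] is the sum of the [cosq]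
    series. The factor [3 ^ m k] dominates [cosq], so convergence is uniform, and continuity and
    integrals pass to the limit. *)
Lemma cosine_quotient (a : nat -> C) (m : nat -> nat) (h : R -> C) (y : R) :
  -1 < cos y < 1 ->
  ex_series (fun k => Cmod (a k) * 3 ^ m k) ->
  (forall x, is_series (fun k => (a k * cos (INR (m k) * x))%C) (h x)) ->
  exists (g : R -> C) (I : C),
    (forall x, continuous (U := C_UniformSpace) g x) /\
    (forall x, ((cos x - cos y) * g x)%C = (h x - h y)%C) /\
    is_RInt (V := C_R_NormedModule) g 0 PI I /\
    is_series (fun k => (a k * (PI * chebV (m k) (cos y))%R)%C) I.
Proof.
intros Hy HS Hh.
destruct (uniform_series (fun k x => (a k * cosq (cos y) x (m k))%C)
    (fun k => Cmod (a k) * 3 ^ m k)) as [g Hg]; [|exact HS|].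
{ intros k x; rewrite Cmod_mult, Cmod_R.
  apply Rmult_le_compat_l; [apply Cmod_ge_0|now apply cosq_bound]. }
assert (Hpt : forall x, is_series (fun k => (a k * cosq (cos y) x (m k))%C) (g x)).
{ intros x; apply (filterlim_locally (U := C_UniformSpace)); intros eps.
  generalize (proj1 (filterlim_locally _ _) Hg eps); apply filter_imp; intros n H; exact
      (H x). }
assert (Hc : forall k x, continuous (U := C_UniformSpace)
    (fun x => (a k * cosq (cos y) x (m k))%C) x).
{ intros k x; apply continuous_RtoC, continuous_cosq. }
assert (Hi : forall n, is_RInt (V := C_R_NormedModule)
   (fun x => sum_n (fun k => (a k * cosq (cos y) x (m k))%C) n) 0 PI
   (sum_n (fun k => (a k * (PI * chebV (m k) (cos y))%R)%C) n)).
{ induction n as [|n IH].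
  - rewrite sum_O. apply is_RInt_ext with (fun x => (a 0%nat * cosq (cos y) x (m 0%nat))%C).
    { intros x _; now rewrite sum_O. }
    apply is_RInt_RtoC, is_RInt_cosq.
  - rewrite sum_Sn.
    eapply is_RInt_ext; [intros x _; symmetry; apply (sum_Sn (G := C_AbelianMonoid))|].
    apply (is_RInt_plus (V := C_R_NormedModule)); [exact IH|].
    apply is_RInt_RtoC, is_RInt_cosq. }
destruct (filterlim_RInt (V := C_R_CompleteNormedModule) _ 0 PI eventually _ g _ Hi Hg) as
    [I [HI1 HI2]].
exists g, I; repeat split; [| |exact HI2|exact HI1].
- intros x.
  apply (filterlim_switch_1 (U := C_R_NormedModule) eventually _ (locally x) _
     (fun n x => sum_n (fun k => (a k * cosq (cos y) x (m k))%C) n) g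
     (fun n => sum_n (fun k => (a k * cosq (cos y) x (m k))%C) n) (g x) Hg); [|apply Hpt].
  intros n; induction n as [|n IH].
  + rewrite sum_O.
    apply (filterlim_ext (fun x => (a 0%nat * cosq (cos y) x (m 0%nat))%C)); [|apply Hc].
    intros z; now rewrite sum_O.
  + rewrite sum_Sn.
    eapply filterlim_ext; [intros z; symmetry; apply (sum_Sn (G := C_AbelianMonoid))|].
    apply (continuous_plus (V := C_R_NormedModule)
        (fun x => sum_n (G := C_AbelianMonoid) (fun k => (a k * cosq (cos y) x (m k))%C) n));
            [exact IH|].
    apply Hc.
- intros x.
  (* Both sides are limits of the same partial sums, since [cosq_spec] identifies the terms. *)
  apply (filterlim_locally_unique (V := C_NormedModule) (F := eventually)
    (sum_n (fun k => ((cos x - cos y) * (a k * cosq (cos y) x (m k)))%C))).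
  + apply (is_series_scal (V := C_NormedModule) (cos x - cos y)%C), Hpt.
  + eapply (is_series_ext (V := C_NormedModule));
      [|apply (is_series_minus (V := C_NormedModule) _ _ _ _ (Hh x) (Hh y))].
    intros k; cbv beta.
    change (a k * cos (INR (m k) * x) - a k * cos (INR (m k) * y) =
            (cos x - cos y) * (a k * cosq (cos y) x (m k)))%C.
    transitivity (a k * (cos (INR (m k) * x) - cos (INR (m k) * y))%R)%C;
        [rewrite RtoC_minus; ring|].
    rewrite <- cosq_spec, RtoC_mult, RtoC_minus; ring.
Qed.

(** * Principal values computed from primitives *)

Lemma at_right_lt (a b : R) : a < b -> at_right a (fun x => a < x < b).
Proof.
intros H. assert (P : 0 < b - a) by lra.
exists (mkposreal _ P); intros x Hx Hax.
apply Rabs_lt_between' in Hx; simpl in Hx; lra.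
Qed.

Lemma at_left_lt (a b : R) : a < b -> at_left b (fun x => a < x < b).
Proof.
intros H. assert (P : 0 < b - a) by lra.
exists (mkposreal _ P); intros x Hx Hax.
apply Rabs_lt_between' in Hx; simpl in Hx; lra.
Qed.

(** The fundamental theorem of calculus on [[x, b]], then [x] tends to [a], where [Psi] enters
    through its limit [l]. *)
Lemma is_RInt_gen_at_right (f Psi : R -> C) (a b : R) (l : C) :
  a < b ->
  (forall x, a < x <= b -> is_derive (V := C_R_NormedModule) Psi x (f x)) ->
  (forall x, a < x <= b -> continuous (U := C_UniformSpace) f x) ->
  filterlim Psi (at_right a) (locally l) ->
  is_RInt_gen (V := C_R_NormedModule) f (at_right a) (at_point b) (Psi b - l)%C.
Proof.
intros Hab HD HC HL.
apply (filterlimi_lim_ext_loc (fun ab => (Psi b - Psi (fst ab))%C)).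
- apply (Filter_prod _ _ _ (fun x => a < x < b) (fun x => x = b)).
  + now apply at_right_lt.
  + easy.
  + intros x y Hx ->; simpl.
    apply (is_RInt_derive (V := C_R_CompleteNormedModule) Psi); intros z;
      rewrite Rmin_left, Rmax_right by lra; intros Hz; [apply HD|apply HC]; lra.
- apply (filterlim_comp _ _ _ fst (fun x => (Psi b - Psi x)%C) _ (at_right a));
    [apply filterlim_fst|].
  apply (filterlim_comp_2 (H := locally (- l)%C) (fun _ => Psi b) (fun x => (- Psi x)%C) Cplus
      (F := at_right a) (G := locally (Psi b))).
  + apply filterlim_const.
  + eapply filterlim_comp; [exact HL|apply (filterlim_opp (V := C_R_NormedModule))].
  + apply (filterlim_plus (V := C_R_NormedModule)).
Qed.

Lemma is_RInt_gen_at_left (f Psi : R -> C) (a b : R) (l : C) :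
  a < b ->
  (forall x, a <= x < b -> is_derive (V := C_R_NormedModule) Psi x (f x)) ->
  (forall x, a <= x < b -> continuous (U := C_UniformSpace) f x) ->
  filterlim Psi (at_left b) (locally l) ->
  is_RInt_gen (V := C_R_NormedModule) f (at_point a) (at_left b) (l - Psi a)%C.
Proof.
intros Hab HD HC HL.
apply (filterlimi_lim_ext_loc (fun ab => (Psi (snd ab) - Psi a)%C)).
- apply (Filter_prod _ _ _ (fun x => x = a) (fun x => a < x < b)).
  + easy.
  + now apply at_left_lt.
  + intros x y -> Hx; simpl.
    apply (is_RInt_derive (V := C_R_CompleteNormedModule) Psi); intros z;
      rewrite Rmin_left, Rmax_right by lra; intros Hz; [apply HD|apply HC]; lra.
- apply (filterlim_comp _ _ _ snd (fun x => (Psi x - Psi a)%C) _ (at_left b));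
    [apply filterlim_snd|].
  apply (filterlim_comp_2 (H := locally (- Psi a)%C) Psi (fun x => (- Psi a)%C) Cplus
      (F := at_left b) (G := locally l)).
  + exact HL.
  + apply filterlim_const.
  + apply (filterlim_plus (V := C_R_NormedModule)).
Qed.

(** The two outer integrals add up to [(lb - la) + (Psi (t - e) - Psi (t + e))], so [Psi] may blow
    up at [t] as long as it does so symmetrically. *)
Lemma is_PV_int_primitive (f Psi : R -> C) (a b t : R) (la lb : C) :
  a < t < b ->
  (forall x, a < x < b -> x <> t -> is_derive (V := C_R_NormedModule) Psi x (f x)) ->
  (forall x, a < x < b -> x <> t -> continuous (U := C_UniformSpace) f x) ->
  filterlim Psi (at_right a) (locally la) ->
  filterlim Psi (at_left b) (locally lb) ->
  filterlim (fun e : R => (Psi (t - e)%R - Psi (t + e)%R)%C) (at_right 0) (locally (RtoC 0)) ->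
  is_PV_int f a b t (lb - la)%C.
Proof.
intros Ht HD HC Ha Hb H0.
exists (fun e : R => (Psi (t - e)%R - la)%C), (fun e : R => (lb - Psi (t + e)%R)%C); split.
(* For [e] below this minimum, both [t - e] and [t + e] stay in []a, b[]. *)
- assert (P : 0 < Rmin (t - a) (b - t)) by (apply Rmin_pos; lra).
  generalize (at_right_lt _ _ P); apply filter_imp; intros e He.
  assert (M1 := Rmin_l (t - a) (b - t)); assert (M2 := Rmin_r (t - a) (b - t)).
  split; [apply is_RInt_gen_at_right|apply is_RInt_gen_at_left]; try assumption; try lra;
    intros x Hx; (apply HD || apply HC); lra.
- apply (filterlim_ext (fun e : R => ((lb - la) + (Psi (t - e)%R - Psi (t + e)%R))%C)).
  { intros e; ring. }
  replace (locally (lb - la)%C) with (locally (lb - la + 0)%C) by (f_equal; ring).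
  apply (filterlim_comp_2 (H := locally (RtoC 0)) (fun _ => lb - la)%C
      (fun e : R => (Psi (t - e)%R - Psi (t + e)%R)%C) Cplus (F := at_right 0)
          (G := locally (lb - la)%C)).
  + apply filterlim_const.
  + exact H0.
  + apply (filterlim_plus (V := C_R_NormedModule)).
Qed.

(** Agreement is asked only away from [a], [b] and [t], so later rewritings may divide by
    [sqrt (1 - s ^ 2)] and by [t - s]. *)
Lemma is_PV_int_ext (f g : R -> C) (a b t : R) (l : C) :
  a < t < b ->
  (forall x, a < x < b -> x <> t -> f x = g x) ->
  is_PV_int f a b t l -> is_PV_int g a b t l.
Proof.
intros Ht E [J1 [J2 [HJ HL]]]; exists J1, J2; split; [|exact HL].
assert (P : 0 < Rmin (t - a) (b - t)) by (apply Rmin_pos; lra).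
generalize (filter_and _ _ (at_right_lt _ _ P) HJ); apply filter_imp; intros e [He [H1 H2]].
assert (M1 := Rmin_l (t - a) (b - t)); assert (M2 := Rmin_r (t - a) (b - t)).
split.
- refine (is_RInt_gen_ext _ _ _ _ H1).
  apply (Filter_prod _ _ _ (fun x => a < x < t - e) (fun x => x = t - e)).
  + apply at_right_lt; lra.
  + easy.
  + intros x y Hx -> z; simpl; rewrite Rmin_left, Rmax_right by lra; intros Hz; apply E; lra.
- refine (is_RInt_gen_ext _ _ _ _ H2).
  apply (Filter_prod _ _ _ (fun x => x = t + e) (fun x => t + e < x < b)).
  + easy.
  + apply at_left_lt; lra.
  + intros x y -> Hx z; simpl; rewrite Rmin_left, Rmax_right by lra; intros Hz; apply E; lra.
Qed.

Lemma is_PV_int_plus (f g : R -> C) (a b t : R) (l m : C) :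
  is_PV_int f a b t l -> is_PV_int g a b t m ->
  is_PV_int (fun x => (f x + g x)%C) a b t (l + m)%C.
Proof.
intros [J1 [J2 [HJ LJ]]] [K1 [K2 [HK LK]]].
exists (fun e : R => (J1 e + K1 e)%C), (fun e : R => (J2 e + K2 e)%C); split.
- generalize (filter_and _ _ HJ HK); apply filter_imp; intros e [[A1 A2] [B1 B2]].
  split; apply (is_RInt_gen_plus (V := C_R_NormedModule)); assumption.
- apply (filterlim_ext (fun e : R => ((J1 e + J2 e) + (K1 e + K2 e))%C)); [intros e; ring|].
  eapply filterlim_comp_2; [exact LJ|exact LK|].
  apply (filterlim_plus (V := C_R_NormedModule)).
Qed.

Lemma scal_C_R (r : R) (z : C) : scal (V := C_R_ModuleSpace) r z = (r * z)%C.
Proof.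
destruct z as [u v]; unfold scal; simpl; unfold prod_scal, scal; simpl; unfold mult; simpl.
unfold Cmult, RtoC; simpl; f_equal; ring.
Qed.

Lemma is_PV_int_scal (f : R -> C) (a b t r : R) (l : C) :
  is_PV_int f a b t l -> is_PV_int (fun x => (r * f x)%C) a b t (r * l)%C.
Proof.
intros [J1 [J2 [HJ LJ]]].
exists (fun e : R => (r * J1 e)%C), (fun e : R => (r * J2 e)%C); split.
- revert HJ; apply filter_imp; intros e [A1 A2].
  split; rewrite <- scal_C_R.
  + apply (is_RInt_gen_ext (V := C_R_NormedModule) (fun x => scal r (f x))).
    { apply filter_forall; intros ab x _; apply scal_C_R. }
    now apply (is_RInt_gen_scal (V := C_R_NormedModule)).
  + apply (is_RInt_gen_ext (V := C_R_NormedModule) (fun x => scal r (f x))).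
    { apply filter_forall; intros ab x _; apply scal_C_R. }
    now apply (is_RInt_gen_scal (V := C_R_NormedModule)).
- rewrite <- scal_C_R.
  apply (filterlim_ext (fun e : R => scal (V := C_R_ModuleSpace) r (J1 e + J2 e)%C)).
  { intros e; rewrite scal_C_R; apply Cmult_plus_distr_l. }
  eapply filterlim_comp; [exact LJ|apply (filterlim_scal_r (V := C_R_NormedModule))].
Qed.

(** * The substitution [s = cos x] *)

Lemma filterlim_acos_m1 : filterlim acos (at_right (-1)) (locally PI).
Proof.
assert (HP := PI_RGT_0).
apply filterlim_locally; intros eps.
(* Capping [d] at [PI] keeps [PI - d] in [[0, PI]], where [cos] decreases; monotonicity then turns
   closeness of [x] to -1 into closeness of [acos x] to [PI]. *)
assert (Hd : 0 < Rmin eps PI) by (apply Rmin_pos; [apply cond_pos|lra]).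
assert (M1 := Rmin_l eps PI); assert (M2 := Rmin_r eps PI).
set (d := Rmin eps PI) in *.
assert (Hc : -1 < cos (PI - d)).
{ rewrite <- cos_PI; apply cos_decreasing_1; lra. }
generalize (at_right_lt _ _ Hc); apply filter_imp; intros x Hx.
assert (B := acos_bound x).
assert (C := COS_bound (PI - d)).
apply Rabs_lt_between'; split; [|lra].
apply Rle_lt_trans with (PI - d); [lra|].
apply Rnot_le_lt; intros Hle.
assert (cos (PI - d) <= cos (acos x)) by (apply cos_decr_1; lra).
rewrite cos_acos in H; lra.
Qed.

Lemma filterlim_acos_1 : filterlim acos (at_left 1) (locally 0).
Proof.
assert (HP := PI_RGT_0).
apply filterlim_locally; intros eps.
assert (Hd : 0 < Rmin eps PI) by (apply Rmin_pos; [apply cond_pos|lra]).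
assert (M1 := Rmin_l eps PI); assert (M2 := Rmin_r eps PI).
set (d := Rmin eps PI) in *.
assert (Hc : cos d < 1).
{ rewrite <- cos_0; apply cos_decreasing_1; lra. }
generalize (at_left_lt _ _ Hc); apply filter_imp; intros x Hx.
assert (B := acos_bound x).
assert (C := COS_bound d).
apply Rabs_lt_between'; split; [destruct eps; simpl in *; lra|].
apply Rlt_le_trans with d; [|lra].
apply Rnot_le_lt; intros Hle.
assert (cos (acos x) <= cos d) by (apply cos_decr_1; lra).
rewrite cos_acos in H; lra.
Qed.

Lemma is_derive_acos (x : R) : -1 < x < 1 -> is_derive acos x (- / sqrt (1 - x ^ 2)).
Proof.
intros Hx; apply is_derive_Reals.
replace (- / sqrt (1 - x ^ 2)) with (derive_pt acos x (derivable_pt_acos x Hx)).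
- apply derive_pt_eq_1 with (derivable_pt_acos x Hx); reflexivity.
- rewrite derive_pt_acos.
  replace (1 - x ^ 2) with (1 - x²) by (unfold Rsqr; ring).
  field; apply Rgt_not_eq, sqrt_lt_R0; unfold Rsqr; nra.
Qed.

Lemma sqrt_1_sq_pos (x : R) : -1 < x < 1 -> 0 < sqrt (1 - x ^ 2).
Proof. intros Hx; apply sqrt_lt_R0; nra. Qed.

Lemma continuous_inv_sqrt (x : R) : -1 < x < 1 -> continuous (fun x => / sqrt (1 - x ^ 2)) x.
Proof.
intros Hx; apply (ex_derive_continuous (V := R_NormedModule)).
assert (P := sqrt_1_sq_pos x Hx).
auto_derive; repeat split; try nra.
apply Rgt_not_eq; replace (x * (x * 1)) with (x ^ 2) by ring; exact P.
Qed.

Lemma filterlim_sym_diff (Psi : R -> C) (t : R) :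
  continuous (U := C_UniformSpace) Psi t ->
  filterlim (fun e : R => (Psi (t - e)%R - Psi (t + e)%R)%C) (at_right 0) (locally (RtoC 0)).
Proof.
intros H.
replace (locally (RtoC 0)) with (locally (Psi t + - Psi t)%C) by (f_equal; ring).
assert (A : forall s : R, filterlim (fun e => t + s * e) (at_right 0) (locally t)).
{ intros s; apply (filterlim_filter_le_1 (F := locally 0)); [apply filter_le_within|].
  replace (locally t) with (locally (t + s * 0)) by (f_equal; ring).
  apply (ex_derive_continuous (V := R_NormedModule) (fun e => t + s * e)).
  auto_derive; easy. }
apply (filterlim_comp_2 (H := locally (- Psi t)%C) (fun e => Psi (t - e)%R)
    (fun e => (- Psi (t + e)%R)%C) Cplus (G := locally (Psi t))).
- eapply filterlim_comp; [|exact H].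
  apply (filterlim_ext (fun e => t + -1 * e)); [intros e; ring|apply A].
- eapply filterlim_comp; [|apply (filterlim_opp (V := C_R_NormedModule))].
  eapply filterlim_comp; [|exact H].
  apply (filterlim_ext (fun e => t + 1 * e)); [intros e; ring|apply A].
- apply (filterlim_plus (V := C_R_NormedModule)).
Qed.

Lemma continuous_Cmult_R (r : R -> R) (g : R -> C) (x : R) :
  continuous r x -> continuous (U := C_UniformSpace) g x ->
  continuous (U := C_UniformSpace) (fun x => (r x * g x)%C) x.
Proof.
intros Hr Hg.
apply (continuous_ext (U := C_UniformSpace) (fun x => scal (V := C_R_NormedModule) (r x)
    (g x))).
- intros y; apply scal_C_R.
- now apply (continuous_scal (V := C_R_NormedModule)).
Qed.

(** A primitive of the integrand is [- Phi (acos s)], with a minus sign because [acos] decreases. It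
    is continuous at [t], so the excised part tends to 0. *)
Lemma is_PV_int_acos (g : R -> C) (t : R) (I : C) :
  -1 < t < 1 ->
  (forall x, continuous (U := C_UniformSpace) g x) ->
  is_RInt (V := C_R_NormedModule) g 0 PI I ->
  is_PV_int (fun s => ((/ sqrt (1 - s ^ 2))%R * g (acos s))%C) (-1) 1 t I.
Proof.
intros Ht Hg HI.
pose (Phi := (fun x => RInt (V := C_R_CompleteNormedModule) g 0 x) : R -> C).
assert (HPhi : forall x, is_derive (V := C_R_NormedModule) Phi x (g x)).
{ intros x; apply (is_derive_RInt (V := C_R_NormedModule) g Phi 0); [|apply Hg].
  apply filter_forall; intros y; apply (RInt_correct (V := C_R_CompleteNormedModule)).
  apply (ex_RInt_continuous (V := C_R_CompleteNormedModule)); intros z _; apply Hg. }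
assert (CPhi : forall x, continuous (U := C_UniformSpace) Phi x).
{ intros x; apply (ex_derive_continuous (V := C_R_NormedModule)); eexists; apply HPhi. }
assert (E0 : Phi 0 = RtoC 0) by apply (RInt_point (V := C_R_CompleteNormedModule)).
assert (EPI : Phi PI = I) by (apply (is_RInt_unique (V := C_R_CompleteNormedModule)); exact HI).
assert (HD : forall x, -1 < x < 1 -> is_derive (V := C_R_NormedModule)
          (fun x => (- Phi (acos x))%C) x ((/ sqrt (1 - x ^ 2))%R * g (acos x))%C).
{ intros x Hx.
  replace ((/ sqrt (1 - x ^ 2))%R * g (acos x))%C
    with (opp (G := C_R_NormedModule) (scal (V := C_R_NormedModule) (- / sqrt (1 - x ^ 2))
        (g (acos x)))).
  - apply (is_derive_opp (V := C_R_NormedModule) (fun x => Phi (acos x))).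
    apply (is_derive_comp (V := C_R_NormedModule)); [apply HPhi|now apply is_derive_acos].
  - rewrite scal_C_R.
    change (- ((- / sqrt (1 - x ^ 2))%R * g (acos x)) = (/ sqrt (1 - x ^ 2))%R * g (acos x))%C.
    rewrite RtoC_opp; ring. }
assert (HC : forall x, -1 < x < 1 -> continuous (U := C_UniformSpace)
    (fun x => ((/ sqrt (1 - x ^ 2))%R * g (acos x))%C) x).
{ intros x Hx.
  apply continuous_Cmult_R; [now apply continuous_inv_sqrt|].
  apply (continuous_comp acos g); [|apply Hg].
  apply (ex_derive_continuous (V := R_NormedModule)).
  eexists; now apply is_derive_acos. }
(* [acos] tends to [0] at [1] and to [PI] at [-1]. *)
replace I with (- Phi 0 - - Phi PI)%C by (rewrite E0, EPI; ring).
apply (is_PV_int_primitive _ (fun x => (- Phi (acos x))%C)); try assumption; auto.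
- eapply filterlim_comp; [|apply (filterlim_opp (V := C_R_NormedModule))].
  eapply filterlim_comp; [apply filterlim_acos_m1|apply CPhi].
- eapply filterlim_comp; [|apply (filterlim_opp (V := C_R_NormedModule))].
  eapply filterlim_comp; [apply filterlim_acos_1|apply CPhi].
- apply (filterlim_sym_diff (fun x => (- Phi (acos x))%C)),
    (ex_derive_continuous (V := C_R_NormedModule)).
  eexists; now apply HD.
Qed.

(** * The weighted Cauchy kernel without numerator *)

(* With [s = cos x], [t = cos y], the argument of the logarithm is [1 - cos (x + y)]. *)
Definition cauchy_log (t s : R) : R :=
  ln (1 - s * t + sqrt (1 - s ^ 2) * sqrt (1 - t ^ 2)).

(* [ln ((s - t) ^ 2) / 2] is [ln |s - t|]. *)
Definition cauchy_prim (t s : R) : R :=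
  (cauchy_log t s - ln ((s - t) ^ 2) / 2) / sqrt (1 - t ^ 2).

Lemma cauchy_log_arg_pos (t s : R) : -1 < t < 1 -> -1 <= s <= 1 ->
  0 < 1 - s * t + sqrt (1 - s ^ 2) * sqrt (1 - t ^ 2).
Proof.
intros Ht Hs.
assert (0 <= sqrt (1 - s ^ 2) * sqrt (1 - t ^ 2)) by (apply Rmult_le_pos; apply sqrt_pos).
assert (0 < 1 - s * t) by (destruct (Rle_dec s 0); destruct (Rle_dec t 0); nra).
lra.
Qed.

(** [sqrt] is 0 on negative arguments, hence continuous everywhere; this gives two-sided continuity
    even at [s = 1] and [s = -1]. *)
Lemma continuous_sqrt_1_sq (s : R) : continuous (fun s => sqrt (1 - s ^ 2)) s.
Proof.
apply (continuous_comp (fun s => 1 - s ^ 2) sqrt).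
- apply (ex_derive_continuous (V := R_NormedModule)); auto_derive; easy.
- apply continuous_sqrt.
Qed.

Lemma continuous_cauchy_log (t s : R) : -1 < t < 1 -> -1 <= s <= 1 ->
  continuous (cauchy_log t) s.
Proof.
intros Ht Hs.
apply (continuous_comp (fun s => 1 - s * t + sqrt (1 - s ^ 2) * sqrt (1 - t ^ 2)) ln).
- apply (continuous_plus (V := R_NormedModule) (fun s => 1 - s * t)).
  + apply (ex_derive_continuous (V := R_NormedModule)); auto_derive; easy.
  + apply (continuous_mult (K := R_AbsRing)); [apply continuous_sqrt_1_sq|apply
      continuous_const].
- apply continuous_ln, cauchy_log_arg_pos; assumption.
Qed.

Lemma is_derive_cauchy_prim (t s : R) : -1 < t < 1 -> -1 < s < 1 -> s <> t ->
  is_derive (cauchy_prim t) s (/ sqrt (1 - s ^ 2) * / (t - s)).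
Proof.
intros Ht Hs Hst; unfold cauchy_prim, cauchy_log.
assert (P := cauchy_log_arg_pos t s Ht ltac:(lra)).
assert (Q := sqrt_1_sq_pos s Hs).
assert (Q' := sqrt_1_sq_pos t Ht).
assert (E := sqrt_sqrt (1 - s ^ 2) ltac:(nra)).
assert (E' := sqrt_sqrt (1 - t ^ 2) ltac:(nra)).
assert (D : 0 < (s - t) ^ 2) by (apply pow2_gt_0; lra).
auto_derive; replace (1 + - (s * (s * 1))) with (1 - s ^ 2) by ring;
  replace (1 - t * (t * 1)) with (1 - t ^ 2) by ring.
- repeat split; try easy; try nra.
- revert P Q Q' E E'; generalize (sqrt (1 - s ^ 2)) (sqrt (1 - t ^ 2)); intros u v P Q Q' E E'.
  replace (1 + - (s * t) + u * v) with (1 - s * t + u * v) by ring.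
  set (w := 1 - s * t + u * v) in *.
  (* Over a common denominator, the two logarithmic derivatives have the left side of [K] as
     numerator, up to sign. The relations [u^2 = 1 - s^2] and [v^2 = 1 - t^2] reduce it to [v * w],
     which cancels. *)
  assert (K : (t * u + s * v) * (s - t) + u * w = v * w).
  { unfold w.
    transitivity (u * (1 - t ^ 2) + v * (u * u + s ^ 2) - s * t * v); [ring|].
    rewrite <- E', E; ring. }
  transitivity (- ((t * u + s * v) * (s - t) + u * w) / (u * w * (s - t) * v)).
  + field; repeat split; lra.
  + rewrite K; field; repeat split; lra.
Qed.

(** The primitive vanishes at both end points, and its logarithmic singularity is even about [t], so
    symmetric excision removes it. *)
Lemma is_PV_int_cauchy (t : R) (c : C) :
  -1 < t < 1 ->
  is_PV_int (fun s => ((/ sqrt (1 - s ^ 2) * / (t - s))%R * c)%C) (-1) 1 t (RtoC 0).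
Proof.
intros Ht.
assert (HC : forall x, -1 <= x <= 1 -> x <> t -> continuous (cauchy_prim t) x).
{ intros x Hx Hxt.
  apply (continuous_mult (K := R_AbsRing) (fun s => cauchy_log t s - ln ((s - t) ^ 2) / 2)).
  - apply (continuous_minus (V := R_NormedModule)); [now apply continuous_cauchy_log|].
    assert (D : 0 < (x - t) ^ 2) by (apply pow2_gt_0; lra).
    apply (ex_derive_continuous (V := R_NormedModule)); auto_derive.
    replace ((x + - t) * ((x + - t) * 1)) with ((x - t) ^ 2) by ring; easy.
  - apply continuous_const. }
assert (CC : forall x, continuous (cauchy_prim t) x ->
             continuous (U := C_UniformSpace) (fun s => (cauchy_prim t s * c)%C) x).
{ intros x Hx; apply continuous_Cmult_R; [exact Hx|apply continuous_const]. }
(* At [s = 1] and [s = -1] the argument of [cauchy_log] reduces to [|s - t|], so the two logarithms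
   cancel. *)
assert (E1 : cauchy_prim t 1 = 0 /\ cauchy_prim t (-1) = 0).
{ unfold cauchy_prim, cauchy_log; split.
  - replace (1 - 1 ^ 2) with 0 by ring; rewrite sqrt_0.
    replace ((1 - t) ^ 2) with ((1 - t) * (1 - t)) by ring.
    rewrite ln_mult by lra.
    replace (1 - 1 * t + 0 * sqrt (1 - t ^ 2)) with (1 - t) by ring.
    unfold Rdiv; replace (_ - _) with 0 by field; ring.
  - replace (1 - (-1) ^ 2) with 0 by ring; rewrite sqrt_0.
    replace ((-1 - t) ^ 2) with ((1 + t) * (1 + t)) by ring.
    rewrite ln_mult by lra.
    replace (1 - -1 * t + 0 * sqrt (1 - t ^ 2)) with (1 + t) by ring.
    unfold Rdiv; replace (_ - _) with 0 by field; ring. }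
destruct E1 as [E1 Em1].
replace (RtoC 0) with (cauchy_prim t 1 * c - cauchy_prim t (-1) * c)%C by
    (rewrite E1, Em1; ring).
apply (is_PV_int_primitive _ (fun s => (cauchy_prim t s * c)%C)).
- exact Ht.
- intros x Hx Hxt.
  rewrite <- scal_C_R.
  apply (is_derive_ext (V := C_R_NormedModule)
      (fun s => scal (V := C_R_NormedModule) (cauchy_prim t s) c)).
  { intros s; apply scal_C_R. }
  apply (is_derive_scal_l (V := C_R_NormedModule)).
  now apply is_derive_cauchy_prim.
- intros x Hx Hxt; apply continuous_Cmult_R; [|apply continuous_const].
  apply (continuous_mult (K := R_AbsRing)); [now apply continuous_inv_sqrt|].
  apply (ex_derive_continuous (V := R_NormedModule)); auto_derive; lra.
- apply (filterlim_filter_le_1 (F := locally (-1))); [apply filter_le_within|].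
  apply (CC (-1)), HC; lra.
- apply (filterlim_filter_le_1 (F := locally 1)); [apply filter_le_within|].
  apply (CC 1), HC; lra.
(* [ln ((s - t) ^ 2)] agrees at [t - e] and [t + e]; only the continuous part [cauchy_log] survives
   in the difference. *)
- assert (L := filterlim_sym_diff (fun s => ((cauchy_log t s / sqrt (1 - t ^ 2))%R * c)%C) t).
  refine (filterlim_ext _ _ _ (L _)).
  + assert (S : forall s, cauchy_prim t s
        = cauchy_log t s / sqrt (1 - t ^ 2) - ln ((s - t) ^ 2) / 2 / sqrt (1 - t ^ 2))
      by (intros s; unfold cauchy_prim, Rdiv; ring).
    intros e; rewrite !S, !RtoC_minus.
    replace ((t - e - t) ^ 2) with ((t + e - t) ^ 2) by ring. ring.
  + apply continuous_Cmult_R; [|apply continuous_const].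
    apply (continuous_mult (K := R_AbsRing)); [|apply continuous_const].
    apply continuous_cauchy_log; lra.
Qed.

(** * Principal values of cosine series *)

Lemma is_PV_int_cosine_series (a : nat -> C) (m : nat -> nat) (h : R -> C) (y : R) :
  -1 < cos y < 1 ->
  ex_series (fun k => Cmod (a k) * 3 ^ m k) ->
  (forall x, is_series (fun k => (a k * cos (INR (m k) * x))%C) (h x)) ->
  exists I : C,
    is_PV_int (fun s => ((/ sqrt (1 - s ^ 2) * / (cos y - s))%R * h (acos s))%C)
      (-1) 1 (cos y) (- I)%C /\
    is_series (fun k => (a k * (PI * chebV (m k) (cos y))%R)%C) I.
Proof.
intros Hy HS Hh.
destruct (cosine_quotient a m h y Hy HS Hh) as [g [I [Hc [Hq [HI Hs]]]]].
exists I; split; [|exact Hs].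
(* Split [h (acos s)] as [h y + (s - cos y) * g (acos s)]. The constant part has principal value 0;
   in the other part [(s - cos y) / (cos y - s)] is the factor [-1]. *)
replace (- I)%C with (RtoC (-1) * I + 0)%C by ring.
refine (is_PV_int_ext _ _ _ _ _ _ Hy _
  (is_PV_int_plus _ _ _ _ _ _ _
    (is_PV_int_scal _ _ _ _ (-1) _ (is_PV_int_acos g (cos y) I Hy Hc HI))
    (is_PV_int_cauchy (cos y) (h y) Hy))).
intros s Hs1 Hst; cbv beta.
assert (E : h (acos s) = (h y + (s - cos y) * g (acos s))%C).
{ generalize (Hq (acos s)); rewrite cos_acos by lra; intros ->; ring. }
rewrite E, !RtoC_mult.
assert (F : (RtoC (/ (cos y - s)) * (s - cos y))%C = RtoC (-1)).
{ rewrite <- RtoC_minus, <- RtoC_mult; f_equal; field; lra. }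
transitivity (RtoC (/ sqrt (1 - s ^ 2)) * ((RtoC (/ (cos y - s)) * (s - cos y)) * g (acos s))
   + RtoC (/ sqrt (1 - s ^ 2)) * RtoC (/ (cos y - s)) * h y)%C; [rewrite F|]; ring.
Qed.

(** * Cosines and sines through [e^{ix}] *)

Definition cis (x : R) : C := (cos x, sin x).

Lemma cis_mult_opp (x : R) : (cis x * cis (- x))%C = 1.
Proof.
unfold cis, Cmult, RtoC; simpl; rewrite cos_neg, sin_neg; f_equal; [|ring].
generalize (sin2_cos2 x); unfold Rsqr; lra.
Qed.

Lemma cis_pow (x : R) (m : nat) : (cis x ^ m)%C = cis (INR m * x).
Proof.
induction m as [|m IH].
- simpl; unfold cis, RtoC; rewrite Rmult_0_l, cos_0, sin_0; reflexivity.
- rewrite Cpow_S, IH, S_INR, Rmult_plus_distr_r, Rmult_1_l.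
  unfold cis, Cmult; simpl; rewrite cos_plus, sin_plus; f_equal; ring.
Qed.

(** The common power of [e^{ix} e^{-ix} = 1] drops out. With truncated subtraction one remaining
    exponent is 0, which replaces a signed power [n - k]. *)
Lemma cis_cancel (x : R) (n k : nat) :
  (cis x ^ n * cis (- x) ^ k)%C = (cis x ^ (n - k) * cis (- x) ^ (k - n))%C.
Proof.
destruct (Nat.le_ge_cases k n) as [H|H].
- replace n with (n - k + k)%nat at 1 by lia; replace (k - n)%nat with 0%nat by lia.
  rewrite Cpow_add_r, <- Cmult_assoc, <- Cpow_mult_l, cis_mult_opp, Cpow_1_l; reflexivity.
- replace k with (n + (k - n))%nat at 1 by lia; replace (n - k)%nat with 0%nat by lia.
  rewrite Cpow_add_r, Cmult_assoc, <- Cpow_mult_l, cis_mult_opp, Cpow_1_l; reflexivity.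
Qed.

Lemma cis_cancel_opp (x : R) (n k : nat) :
  (cis (- x) ^ n * cis x ^ k)%C = (cis (- x) ^ (n - k) * cis x ^ (k - n))%C.
Proof. now rewrite !(Cmult_comm (cis (- x) ^ _)), cis_cancel, Cmult_comm. Qed.

Lemma cos_cis (m : nat) (x : R) :
  RtoC (cos (INR m * x)) = ((cis x ^ m + cis (- x) ^ m) / 2)%C.
Proof.
rewrite !cis_pow, Ropp_mult_distr_r_reverse.
unfold cis; rewrite cos_neg, sin_neg.
replace (_ + _)%C with (RtoC (2 * cos (INR m * x))) by
    (unfold Cplus, RtoC; simpl; f_equal; ring).
rewrite RtoC_mult; field.
Qed.

Lemma sin_cis (m : nat) (x : R) :
  RtoC (sin (INR m * x)) = ((cis x ^ m - cis (- x) ^ m) / (2 * Ci))%C.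
Proof.
rewrite !cis_pow, Ropp_mult_distr_r_reverse.
unfold cis; rewrite cos_neg, sin_neg.
replace (_ - _)%C with (2 * Ci * RtoC (sin (INR m * x)))%C
  by (unfold Cminus, Cplus, Cmult, Copp, Ci, RtoC; simpl; f_equal; ring).
field; exact Ci_nz.
Qed.

Definition absdiff (n k : nat) : nat := ((n - k) + (k - n))%nat.

Lemma cos_absdiff_cis (n k : nat) (x : R) :
  RtoC (cos (INR (absdiff n k) * x)) =
  ((cis x ^ n * cis (- x) ^ k + cis (- x) ^ n * cis x ^ k) / 2)%C.
Proof.
rewrite cos_cis, cis_cancel, cis_cancel_opp; unfold absdiff.
destruct (Nat.le_ge_cases k n) as [H|H].
- replace (k - n)%nat with 0%nat by lia; rewrite Nat.add_0_r; simpl (_ ^ 0)%C; field.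
- replace (n - k)%nat with 0%nat by lia; rewrite Nat.add_0_l; simpl (_ ^ 0)%C; field.
Qed.

(* The first term on the right vanishes for [n <= k] (truncated subtraction); the
   second is [sin ((n - k) x)] with signed difference. *)
Lemma chebV_absdiff_cis (n k : nat) (x : R) :
  (sin x * chebV (absdiff n k) (cos x))%C =
  (2 * sin x * chebV (n - k) (cos x)
   - (cis x ^ n * cis (- x) ^ k - cis (- x) ^ n * cis x ^ k) / (2 * Ci))%C.
Proof.
rewrite <- (Cmult_assoc 2), <- !(RtoC_mult (sin x)), !chebV_sin, !sin_cis, cis_cancel,
    cis_cancel_opp.
unfold absdiff; destruct (Nat.le_ge_cases k n) as [H|H].
- replace (k - n)%nat with 0%nat by lia; rewrite Nat.add_0_r; simpl (_ ^ 0)%C.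
  field; exact Ci_nz.
- replace (n - k)%nat with 0%nat by lia; rewrite Nat.add_0_l; simpl (_ ^ 0)%C.
  field; exact Ci_nz.
Qed.

(** * Exponential series with trigonometric factors *)

Lemma Cexp_term_mult (z w : C) (k : nat) :
  Cexp_term (z * w) k = (Cexp_term z k * w ^ k)%C.
Proof. unfold Cexp_term; rewrite Cpow_mult_l; ring. Qed.

Lemma is_series_C_ext (a b : nat -> C) (l : C) :
  (forall k, a k = b k) -> is_series a l -> is_series b l.
Proof. apply (is_series_ext (V := C_NormedModule)). Qed.

Lemma is_series_Cexp_scal (c z w : C) :
  is_series (fun k => (c * (Cexp_term z k * w ^ k))%C) (c * Cexp (z * w))%C.
Proof.
eapply is_series_C_ext.
2: apply (is_series_scal (V := C_NormedModule) c _ _ (is_series_Cexp (z * w))).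
intros k; cbv beta; now rewrite Cexp_term_mult.
Qed.

(** With [e^{ix}] and [e^{-ix}] for [w] and [w'], this sums the cosine and the sine series alike. *)
Lemma is_series_Cexp_two (c d z w w' : C) :
  is_series (fun k => (Cexp_term z k * (c * w ^ k + d * w' ^ k))%C)
    (c * Cexp (z * w) + d * Cexp (z * w'))%C.
Proof.
eapply is_series_C_ext.
2: apply (is_series_plus (V := C_NormedModule) _ _ _ _ (is_series_Cexp_scal c z w)
    (is_series_Cexp_scal d z w')).
intros k; cbv beta.
change (c * (Cexp_term z k * w ^ k) + d * (Cexp_term z k * w' ^ k)
  = Cexp_term z k * (c * w ^ k + d * w' ^ k))%C; ring.
Qed.

(** The bound on [m] covers both frequencies [n + k] and [|n - k|]; the majorant is [|c| 3^n] times
    the exponential series of [3|z|]. *)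
Lemma ex_series_Cexp_term (c z : C) (m : nat -> nat) (n : nat) :
  (forall k, (m k <= n + k)%nat) ->
  ex_series (fun k => Cmod (c * Cexp_term z k) * 3 ^ m k).
Proof.
intros Hm.
apply (ex_series_le (V := R_CompleteNormedModule) _
  (fun k => Cmod c * 3 ^ n * ((3 * Cmod z) ^ k / INR (fact k)))).
- intros k; unfold norm; simpl; unfold abs; simpl.
  assert (P := INR_fact_lt_0 k).
  rewrite Rabs_pos_eq by (apply Rmult_le_pos; [apply Cmod_ge_0|apply pow_le; lra]).
  assert (E : Cmod (c * Cexp_term z k) = Cmod c * (Cmod z ^ k / INR (fact k))).
  { unfold Cexp_term; rewrite !Cmod_mult, Cmod_pow, <- RtoC_div, Cmod_R by lra.
    rewrite Rabs_pos_eq by (apply Rlt_le, Rdiv_lt_0_compat; lra).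
    field; lra. }
  rewrite E, Rpow_mult_distr.
  apply Rle_trans with (Cmod c * (Cmod z ^ k / INR (fact k)) * 3 ^ (n + k)).
  + apply Rmult_le_compat_l; [|apply Rle_pow; [lra|apply Hm]].
    apply Rmult_le_pos; [apply Cmod_ge_0|].
    apply Rmult_le_pos; [apply pow_le, Cmod_ge_0|now apply Rlt_le, Rinv_0_lt_compat].
  + rewrite pow_add; right; field; lra.
- apply (ex_series_scal (V := R_NormedModule) (Cmod c * 3 ^ n)).
  exists (exp (3 * Cmod z)).
  eapply is_series_ext; [|exact (is_exp_Reals (3 * Cmod z))].
  intros k; unfold scal; simpl; unfold mult; simpl.
  rewrite pow_n_pow; reflexivity.
Qed.

Lemma is_series_finite (a : nat -> C) (N : nat) :
  (forall k, (N < k)%nat -> a k = RtoC 0) -> is_series a (sum_n a N).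
Proof.
intros H.
apply (filterlim_ext_loc (fun _ => sum_n a N)); [|apply filterlim_const].
exists N; intros n Hn; induction Hn as [|n Hn IH]; [reflexivity|].
rewrite sum_Sn, <- IH, H by lia.
symmetry; apply Cplus_0_r.
Qed.

(** * Cancellation of the two infinite tails *)

Lemma RtoC_neq_0 (x : R) : x <> 0 -> RtoC x <> 0.
Proof. intros H E; apply H; exact (RtoC_inj _ _ E). Qed.

(** The constants [e], [e'] stand for [e^{mu t}/4] and [e^{-mu t}/4] with [t = cos y]. The two
    equations between them then express [2 cos y = e^{iy} + e^{-iy}], and they match the closed
    forms of the two sine series. *)
Lemma is_PV_int_paired_series (mu e e' : C) (n : nat) (y : R) :
  0 < y < PI ->
  (e * Cexp (- mu * cis y) = e' * Cexp (mu * cis (- y)))%C ->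
  (e * Cexp (- mu * cis (- y)) = e' * Cexp (mu * cis y))%C ->
  is_PV_int (fun s => ((/ sqrt (1 - s ^ 2) * / (cos y - s))%R *
     (e * (cis (acos s) ^ n * Cexp (- mu * cis (acos s))
           + cis (- acos s) ^ n * Cexp (- mu * cis (- acos s)))
      + e' * (cis (acos s) ^ n * Cexp (mu * cis (- acos s))
           + cis (- acos s) ^ n * Cexp (mu * cis (acos s)))))%C) (-1) 1 (cos y)
    (- (4 * PI * e' * sum_n (fun k => (Cexp_term mu k * chebV (n - k) (cos y))%C) n))%C.
Proof.
intros Hy He1 He2.
assert (Hs : 0 < sin y) by (apply sin_gt_0; lra).
assert (Hs' : RtoC (sin y) <> 0) by (apply RtoC_neq_0; lra).
assert (Hc : -1 < cos y < 1).
{ split; [rewrite <- cos_PI|rewrite <- cos_0]; apply cos_decreasing_1; lra. }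
(* The factor 2 offsets the 1/2 in [cos z = (e^{iz} + e^{-iz}) / 2]. *)
destruct (is_PV_int_cosine_series (fun k => (2 * e * Cexp_term (- mu) k)%C)
    (fun k => (n + k)%nat)
  (fun x => (e * (cis x ^ n * Cexp (- mu * cis x) + cis (- x) ^ n * Cexp
      (- mu * cis (- x))))%C) y Hc)
  as [I1 [P1 S1]].
{ apply (ex_series_Cexp_term (2 * e) (- mu) _ n); lia. }
{ intros x.
  replace (e * _)%C with (e * cis x ^ n * Cexp (- mu * cis x) + e * cis (- x) ^ n * Cexp
      (- mu * cis (- x)))%C by ring.
  eapply is_series_C_ext; [|apply is_series_Cexp_two].
  intros k; cbv beta; rewrite cos_cis, !Cpow_add_r; field. }
destruct (is_PV_int_cosine_series (fun k => (2 * e' * Cexp_term mu k)%C) (absdiff n)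
  (fun x => (e' * (cis x ^ n * Cexp (mu * cis (- x)) + cis (- x) ^ n * Cexp (mu * cis x)))%C)
      y Hc)
  as [I2 [P2 S2]].
{ apply (ex_series_Cexp_term (2 * e') mu _ n); unfold absdiff; lia. }
{ intros x.
  replace (e' * _)%C with (e' * cis x ^ n * Cexp (mu * cis (- x)) + e' * cis (- x) ^ n * Cexp
      (mu * cis x))%C by ring.
  eapply is_series_C_ext; [|apply is_series_Cexp_two].
  intros k; cbv beta; rewrite cos_absdiff_cis; field. }
(* Multiplied by [sin y], the values [chebV (n + k)] become [sin ((n + k) y)], whose series sums to
   a difference of exponentials. *)
assert (E1 : I1 = (2 * PI * e / (2 * Ci * sin y) *
   (cis y ^ n * Cexp (- mu * cis y) - cis (- y) ^ n * Cexp (- mu * cis (- y))))%C).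
{ apply (filterlim_locally_unique (V := C_NormedModule) (F := eventually) _ _ _ S1).
  set (c := (2 * PI * e / (2 * Ci * sin y))%C).
  replace (c * _)%C with (c * cis y ^ n * Cexp (- mu * cis y) + - c * cis (- y) ^ n * Cexp
      (- mu * cis (- y)))%C by ring.
  eapply is_series_C_ext; [|apply is_series_Cexp_two].
  intros k; cbv beta; unfold c.
  transitivity (2 * e * Cexp_term (- mu) k * PI *
      (RtoC (sin y * chebV (n + k) (cos y)) / sin y))%C.
  - rewrite chebV_sin, sin_cis, !Cpow_add_r; field; split; (exact Hs' || exact Ci_nz).
  - rewrite !RtoC_mult; field; exact Hs'. }
(* [chebV_absdiff_cis] splits the series: the signed sines again sum to exponentials, and the
   truncated [n - k] leaves a finite sum of doubled weight. *)
assert (E2 : I2 = (4 * PI * e' * sum_n (fun k => (Cexp_term mu k * chebV (n - k) (cos y))%C) n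
  - 2 * PI * e' / (2 * Ci * sin y) *
   (cis y ^ n * Cexp (mu * cis (- y)) - cis (- y) ^ n * Cexp (mu * cis y)))%C).
{ apply (filterlim_locally_unique (V := C_NormedModule) (F := eventually) _ _ _ S2).
  set (c := (2 * PI * e' / (2 * Ci * sin y))%C).
  replace (_ - c * _)%C with (4 * PI * e' * sum_n
      (fun k => (Cexp_term mu k * chebV (n - k) (cos y))%C) n
    + (- c * cis y ^ n * Cexp (mu * cis (- y)) + c * cis (- y) ^ n * Cexp (mu * cis y)))%C by
        ring.
  eapply is_series_C_ext.
  2: apply (is_series_plus (V := C_NormedModule));
       [apply (is_series_scal (V := C_NormedModule)), is_series_finite|apply
           is_series_Cexp_two].
  - intros k; cbv beta.
    change (4 * PI * e' * (Cexp_term mu k * chebV (n - k) (cos y)) +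
       Cexp_term mu k * (- c * cis y ^ n * cis (- y) ^ k + c * cis (- y) ^ n * cis y ^ k)
      = 2 * e' * Cexp_term mu k * (PI * chebV (absdiff n k) (cos y))%R)%C.
    transitivity (2 * e' * Cexp_term mu k * PI *
        ((sin y * chebV (absdiff n k) (cos y)) / sin y))%C.
    + rewrite chebV_absdiff_cis; unfold c; field; split; (exact Hs' || exact Ci_nz).
    + rewrite RtoC_mult; field; exact Hs'.
  (* Past [n], truncated subtraction gives index 0, and [chebV 0] is 0. *)
  - intros k Hk; replace (n - k)%nat with 0%nat by lia; simpl chebV; ring. }
replace (- (4 * PI * e' * _))%C with (- I1 + - I2)%C.
- refine (is_PV_int_ext _ _ _ _ _ _ Hc _ (is_PV_int_plus _ _ _ _ _ _ _ P1 P2)).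
  intros s _ _; cbv beta; ring.
- rewrite E1, E2.
  (* Grouping [e] with the exponentials exposes the left sides of the hypotheses; rewriting makes
     the closed forms in [I1] and [I2] cancel. *)
  replace (2 * PI * e / (2 * Ci * sin y) * (cis y ^ n * Cexp (- mu * cis y) - cis (- y) ^ n *
      Cexp (- mu * cis (- y))))%C
    with (2 * PI / (2 * Ci * sin y) * (cis y ^ n * (e * Cexp (- mu * cis y)) - cis (- y) ^ n *
        (e * Cexp (- mu * cis (- y)))))%C
    by (unfold Cdiv; ring).
  rewrite He1, He2; unfold Cdiv; ring.
Qed.

(** * The exponential Chebyshev functions *)

Lemma cis_acos (s : R) : -1 <= s <= 1 ->
  (s + Ci * sqrt (1 - s ^ 2))%C = cis (acos s) /\
  (s - Ci * sqrt (1 - s ^ 2))%C = cis (- acos s).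
Proof.
intros Hs; unfold cis; rewrite cos_neg, sin_neg, cos_acos, sin_acos by exact Hs.
replace (1 - s²) with (1 - s ^ 2) by (unfold Rsqr; ring).
split; unfold Cminus, Cplus, Copp, Cmult, Ci, RtoC; simpl; f_equal; ring.
Qed.

(** At [n = 0] the only term carries [chebV 0 = 0], so the value is 0; the formula for [expU] draws
    on this case. *)
Lemma is_PV_int_expT (mu : C) (n : nat) (t : R) : -1 < t < 1 ->
  is_PV_int
    (fun s : R => (Ccosh (mu * (t - s)) / (t - s) * (expT mu n s / sqrt (1 - s ^ 2)))%C) (-1)
        1 t
    (- (PI * Cexp (- (mu * t)) * sum_n (fun k => (Cexp_term mu k * chebV (n - k) t)%C) n))%C.
Proof.
intros Ht.
assert (Hy := acos_bound_lt t Ht).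
assert (Et : cos (acos t) = t) by (apply cos_acos; lra).
assert (Hcis : forall x, cis x = (cos x + Ci * sin x)%C).
{ intros x; unfold cis, Cplus, Cmult, Ci, RtoC; simpl; f_equal; ring. }
(* The quarter is one 1/2 from [Ccosh] and one from [expT]. *)
assert (K := is_PV_int_paired_series mu (Cexp (mu * t) / 4) (Cexp (- (mu * t)) / 4) n (acos t)
    Hy).
rewrite Et in K.
replace (- (PI * _ * _))%C with
  (- (4 * PI * (Cexp (- (mu * t)) / 4) * sum_n (fun k => (Cexp_term mu k * chebV (n - k) t)%C)
      n))%C by field.
refine (is_PV_int_ext _ _ _ _ _ _ Ht _ (K _ _)).
- intros s Hs Hst; cbv beta.
  unfold Ccosh, expT.
  destruct (cis_acos s ltac:(lra)) as [-> ->].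
  assert (Q := sqrt_1_sq_pos s Hs).
  assert (Q' : RtoC (sqrt (1 - s ^ 2)) <> 0) by (apply RtoC_neq_0; lra).
  assert (Q2 : RtoC (t - s) <> 0) by (apply RtoC_neq_0; lra).
  rewrite RtoC_mult, !RtoC_inv by lra; rewrite RtoC_minus in *.
  assert (X : forall p q r, (p + q)%C = r -> (Cexp p * Cexp q)%C = Cexp r).
  { intros p q r <-; symmetry; apply Cexp_plus. }
  replace (Cexp (mu * (t - s))) with (Cexp (mu * t) * Cexp (- (mu * s)))%C by (apply X; ring).
  replace (Cexp (- (mu * (t - s)))) with (Cexp (- (mu * t)) * Cexp (mu * s))%C by
      (apply X; ring).
  destruct (cis_acos s ltac:(lra)) as [C1 C2].
  rewrite <- C1, <- C2.
  set (w := RtoC (sqrt (1 - s ^ 2))) in *.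
  (* The exponents recombine: [-mu s] and [-i mu w] give [-mu e^{ix}], while [mu s] and [-i mu w]
     give [mu e^{-ix}]; likewise with [i mu w]. *)
  replace (Cexp (- mu * (s + Ci * w))) with (Cexp (- (mu * s)) * Cexp (- (Ci * mu * w)))%C by
      (apply X; ring).
  replace (Cexp (- mu * (s - Ci * w))) with (Cexp (- (mu * s)) * Cexp (Ci * mu * w))%C by
      (apply X; ring).
  replace (Cexp (mu * (s + Ci * w))) with (Cexp (mu * s) * Cexp (Ci * mu * w))%C by
      (apply X; ring).
  replace (Cexp (mu * (s - Ci * w))) with (Cexp (mu * s) * Cexp (- (Ci * mu * w)))%C by
      (apply X; ring).
  field; split; assumption.
(* The exponents agree because [e^{iy} + e^{-iy} = 2 t]. *)
- unfold Cdiv; rewrite <- !(Cmult_assoc), !(Cmult_comm (/ 4)), !Cmult_assoc, <- !Cexp_plus.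
  do 2 f_equal; rewrite !Hcis, cos_neg, sin_neg, RtoC_opp, Et; ring.
- unfold Cdiv; rewrite <- !(Cmult_assoc), !(Cmult_comm (/ 4)), !Cmult_assoc, <- !Cexp_plus.
  do 2 f_equal; rewrite !Hcis, cos_neg, sin_neg, RtoC_opp, Et; ring.
Qed.

(** With [s = cos x], this rests on [1 - e^{2ix} = -2i sin x e^{ix}] and its conjugate. The
    quotients by [sqrt (1 - s ^ 2)] on the right have the shape of the first integrand. *)
Lemma expU_expT (mu : C) (n : nat) (s : R) : -1 < s < 1 ->
  (expU mu n s * sqrt (1 - s ^ 2))%C
    = (/ 2 * ((expT mu n s - expT mu (n + 2) s) / sqrt (1 - s ^ 2)))%C.
Proof.
intros Hs; unfold expU, expT.
assert (Q := sqrt_1_sq_pos s Hs).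
assert (E : (sqrt (1 - s ^ 2) * sqrt (1 - s ^ 2))%C = (1 - s * s)%C).
{ rewrite <- !RtoC_mult, <- RtoC_minus; f_equal; rewrite sqrt_sqrt; nra. }
assert (Q' : RtoC (sqrt (1 - s ^ 2)) <> 0) by (apply RtoC_neq_0; lra).
assert (I2 : (Ci * Ci)%C = (-1)%R) by (unfold Cmult, Ci, RtoC; simpl; f_equal; ring).
set (w := RtoC (sqrt (1 - s ^ 2))) in *.
set (A := Cexp _); set (B := Cexp _).
assert (U1 : (1 - (s + Ci * w) * (s + Ci * w))%C = (- (2 * Ci * w) * (s + Ci * w))%C).
{ transitivity (1 - s * s + Ci * Ci * (w * w) - 2 * Ci * Ci * (w * w) - 2 * Ci * w * s)%C;
    [ring|].
  rewrite <- E.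
  transitivity (w * w + Ci * Ci * (w * w) - 2 * Ci * Ci * (w * w) - 2 * Ci * w * s)%C; [ring|].
  replace (w * w + Ci * Ci * (w * w))%C with (RtoC 0) by (rewrite I2; ring). ring. }
assert (U2 : (1 - (s - Ci * w) * (s - Ci * w))%C = (2 * Ci * w * (s - Ci * w))%C).
{ transitivity (1 - s * s + Ci * Ci * (w * w) - 2 * Ci * Ci * (w * w) + 2 * Ci * w * s)%C;
    [ring|].
  rewrite <- E.
  transitivity (w * w + Ci * Ci * (w * w) - 2 * Ci * Ci * (w * w) + 2 * Ci * w * s)%C; [ring|].
  replace (w * w + Ci * Ci * (w * w))%C with (RtoC 0) by (rewrite I2; ring). ring. }
rewrite !Cpow_add_r.
set (p := (s + Ci * w)%C) in *; set (q := (s - Ci * w)%C) in *.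
transitivity (/ 2 * (/ 2 * (A * p ^ n * (1 - p * p) + B * q ^ n * (1 - q * q)) / w))%C.
- rewrite U1, U2.
  transitivity (/ 2 * (- Ci) * (A * p ^ n * p - B * q ^ n * q))%C.
  + replace (- Ci)%C with (/ Ci)%C; [rewrite !Cpow_1_r; field; split;
      (exact Q' || exact Ci_nz)|].
    transitivity (- (Ci * Ci) * / Ci)%C; [rewrite I2; ring|field; exact Ci_nz].
  + field; exact Q'.
- simpl (_ ^ 2)%C; field; exact Q'.
Qed.

Lemma sum_n_C_ext (a b : nat -> C) (n : nat) :
  (forall k, (k <= n)%nat -> a k = b k) -> sum_n a n = sum_n b n.
Proof. apply (sum_n_ext_loc (G := C_AbelianMonoid)). Qed.

(** The last summand carries [chebV 0 = 0], so undoing the index shift of [chebV] lowers the upper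
    limit by one. *)
Lemma sum_n_Cexp_term_chebV (mu : C) (n : nat) (t : R) :
  sum_n (fun k => (Cexp_term mu k * chebV (S n - k) t)%C) (S n)
  = sum_n (fun k => (1 / INR (fact k) * mu ^ k * chebU (n - k) t)%C) n.
Proof.
rewrite sum_Sn, Nat.sub_diag.
replace (Cexp_term mu (S n) * chebV 0 t)%C with (RtoC 0) by (simpl chebV; ring).
etransitivity; [apply Cplus_0_r|].
apply sum_n_C_ext; intros k Hk.
now replace (S n - k)%nat with (S (n - k)) by lia.
Qed.

Theorem theorem3 (mu : C) (n : nat) (t : R) (hn : (1 <= n)%nat) (ht : -1 < t < 1) :
  (exists I : C,
     is_PV_int
       (fun s : R => (Ccosh (mu * (t - s)) / (t - s)
                        * (expT mu n s / sqrt (1 - s ^ 2)))%C) (-1) 1 t I /\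
     (1 / PI * I)%C =
       (- (Cexp (- (mu * t))
           * sum_n (fun k => 1 / INR (fact k) * mu ^ k * chebU (n - 1 - k) t) (n - 1)))%C)
  /\
  (exists I : C,
     is_PV_int
       (fun s : R => (Ccosh (mu * (t - s)) / (t - s)
                        * expU mu (n - 1) s * sqrt (1 - s ^ 2))%C) (-1) 1 t I /\
     (1 / PI * I)%C =
       (Cexp (- (mu * t)) / 2
        * (if Nat.eqb n 1 then chebU 1 t + mu
           else sum_n (fun k => 1 / INR (fact k) * mu ^ k * chebU (n - k) t) n
                - sum_n (fun k => 1 / INR (fact k) * mu ^ k * chebU (n - 2 - k) t) (n - 2)))%C).
Proof.
assert (HPI : RtoC PI <> 0) by (apply RtoC_neq_0, PI_neq0).
destruct n as [|n]; [lia|clear hn].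
(* From here on [n] is the original index minus one. *)
replace (S n - 1)%nat with n by lia.
split.
- eexists; split; [exact (is_PV_int_expT mu (S n) t ht)|].
  rewrite sum_n_Cexp_term_chebV; field; exact HPI.
- eexists; split.
  (* By [expU_expT] the integrand is half the difference of two first-type integrands, with indices
     [n] and [n + 2], where [n] may be 0. *)
  + refine (is_PV_int_ext _ _ _ _ _ _ ht _
      (is_PV_int_plus _ _ _ _ _ _ _
        (is_PV_int_scal _ _ _ _ (/ 2) _ (is_PV_int_expT mu n t ht))
        (is_PV_int_scal _ _ _ _ (- / 2) _ (is_PV_int_expT mu (n + 2) t ht)))).
    intros s Hs Hst; cbv beta.
    rewrite <- (Cmult_assoc _ (expU mu n s)), expU_expT by exact Hs.
    rewrite RtoC_opp, RtoC_inv by lra; unfold Cdiv; ring.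
  + replace (n + 2)%nat with (S (S n)) by lia.
    rewrite sum_n_Cexp_term_chebV, RtoC_opp, RtoC_inv by lra.
    destruct n as [|n].
    (* Original index 1: the [expT mu 0] integral vanishes, and the other sum consists of
       [chebU 1 t] and [mu]. *)
    * rewrite sum_O, sum_Sn, sum_O.
      unfold plus; simpl (Nat.eqb _ _); cbv iota.
      replace (chebV (0 - 0) t) with 0 by reflexivity.
      simpl; replace (RtoC (2 * t)) with (2 * t)%C by (rewrite RtoC_mult; reflexivity).
      field; exact HPI.
    * rewrite sum_n_Cexp_term_chebV.
      replace (S (S n) - 2)%nat with n by lia.
      simpl (Nat.eqb _ _); cbv iota; field; exact HPI.
Qed.
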